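(* Let $\phi_1,\dots,\phi_N:X\to\mathbb R$ be continuous and consider the following conditions. (A) For all $i\neq j$ in $I$ and all $\alpha,\beta\in\mathbb R$: $\mu\left(\{x\in X:\ \alpha\psi_i(x)-\beta\psi_j(x)+\phi_i(x)-\phi_j(x)=0\}\right)=0$. (B) For all $i\in I$ and all $\alpha\in\mathbb R$: $\mu\left(\{x\in X:\ \phi_i(x)=\alpha\psi_i(x)\}\right)=0$. (C) $\psi_i>0$ on $X$ for every $i\in I$, and for all $i\neq j$ in $I$ and all $\alpha,\beta\in\mathbb R$ with $\alpha^2+\beta^2>0$: $\mu\left(\{x\in X:\ \alpha\psi_i(x)+\beta\psi_j(x)=0\}\right)=0$. Then: (i) If (A) holds and $\vec m$ is an interior point of $S^{\psi}_I$, there exists a unique weak partition $\vec\mu\in\mathcal P^{\psi,w}_{\vec m}$ which maximizes $\int_X\vec\phi\cdot d\vec\mu$ over $\mathcal P^{\psi,w}_{\vec m}$, and this partition is a strong one. (ii) If (A) and (B) hold and $\vec m$ is an interior point of $\underline S^{\psi}_I$, there exists a unique weak subpartition $\vec\mu\in\underline{\mathcal P}^{\psi,w}_{\vec m}$ which maximizes $\int_X\vec\phi\cdot d\vec\mu$ over $\underline{\mathcal P}^{\psi,w}_{\vec m}$, and this subpartition is a strong one. (iii) If, in addition, (C) holds, then the conclusion of (i) holds for every $\vec m\in S^{\psi}_I$ and the conclusion of (ii) holds for every $\vec m\in\underline S^{\psi}_I$.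
   Context: $X$ is a compact Polish space with Borel $\sigma$-algebra $\mathcal B$, $\mu$ is a non-atomic Borel probability measure on $X$, $I=\{1,\dots,N\}$, and $\psi_1,\dots,\psi_N:X\to\mathbb R$ are continuous. For $\vec m\in\mathbb R^N$, $\mathcal P^{\psi}_{\vec m}$ (strong partitions) is the set of $N$-tuples $(X_1,\dots,X_N)$ of sets in $\mathcal B$ with $\bigcup_i X_i=X$, $\mu(X_i\cap X_j)=0$ for $i\ne j$, and $\int_{X_i}\psi_i\,d\mu=m_i$ for all $i\in I$; $\underline{\mathcal P}^{\psi}_{\vec m}$ (strong subpartitions) is defined in the same way with $\bigcup_iX_i\subseteq X$ in place of $\bigcup_i X_i=X$. $S^{\psi}_I=\{\vec m\in\mathbb R^N:\mathcal P^{\psi}_{\vec m}\ne\emptyset\}$, $\underline S^{\psi}_I=\{\vec m\in\mathbb R^N:\underline{\mathcal P}^{\psi}_{\vec m}\neq\emptyset\}$; interior points are taken in $\mathbb R^N$. $\mathcal P^{\psi,w}_{\vec m}$ (weak partitions) is the set of $N$-tuples $\vec\mu=(\mu_1,\dots,\mu_N)$ of non-negative Borel measures on $X$ with $\sum_i\mu_i=\mu$ and $\int_X\psi_i\,d\mu_i=m_i$ for all $i\in I$; $\underline{\mathcal P}^{\psi,w}_{\vec m}$ (weak subpartitions) is defined in the same way with $\sum_i\mu_i\le\mu$. A weak (sub)partition $\vec\mu$ is called strong if there is a strong (sub)partition $(X_1,\dots,X_N)$ for the same $\vec m$ with $\mu_i=\mu\lfloor X_i$ (restriction of $\mu$ to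 $X_i$) for all $i$. $\int_X\vec\phi\cdot d\vec\mu=\sum_{i=1}^N\int_X\phi_i\,d\mu_i$. *)

(* Defs.v *)
From HB Require Import structures.
From mathcomp Require Import all_boot all_order all_algebra.
From mathcomp Require Import all_classical all_reals all_analysis.

Set Implicit Arguments.
Unset Strict Implicit.
Unset Printing Implicit Defensive.

Import Order.TTheory GRing.Theory Num.Theory.
Import numFieldNormedType.Exports.

Local Open Scope classical_set_scope.
Local Open Scope ring_scope.

Definition is_metric (R : realType) (X : Type) (d : X -> X -> R) : Prop :=
  [/\ forall x y, 0 <= d x y,
      forall x y, d x y = 0 <-> x = y,
      forall x y, d x y = d y x
    & forall x y z, d x z <= d x y + d y z].

Definition metric_induces_topology (R : realType) (X : topologicalType)
    (d : X -> X -> R) : Prop :=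
  forall (x : X) (A : set X),
    nbhs x A <-> exists2 e : R, 0 < e & [set y | d x y < e] `<=` A.

Definition metric_complete (R : realType) (X : topologicalType)
    (d : X -> X -> R) : Prop :=
  forall u : nat -> X,
    (forall e : R, 0 < e -> exists n0 : nat, forall p q : nat,
      (n0 <= p)%N -> (n0 <= q)%N -> d (u p) (u q) < e) ->
    exists x : X, u @ \oo --> x.

Definition polish_space (R : realType) (X : topologicalType) : Prop :=
  (exists2 D : set X, countable D & dense D) /\
  (exists d : X -> X -> R,
    [/\ is_metric d, metric_induces_topology d & metric_complete d]).

(* The Borel sets are only available on a pointed type.  This is no loss of
   generality here: a space carrying a probability measure is non-empty. *)
Notation borel X := (g_sigma_algebraType (@open X)).

Definition non_atomic (d : measure_display) (T : measurableType d)
    (R : realType) (mu : set T -> \bar R) : Prop :=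
  forall A : set T, measurable A -> (0 < mu A)%E ->
    exists B : set T, [/\ measurable B, B `<=` A & (0 < mu B < mu A)%E].

Section partitions.
Variables (R : realType) (X : ptopologicalType) (N : nat).
Variable mu : {measure set (borel X) -> \bar R}.
Variables psi phi : 'I_N -> X -> R.

Definition strong_partitions (m : 'rV[R]_N) : set ('I_N -> set (borel X)) :=
  [set X_ | [/\ forall i, measurable (X_ i),
                \bigcup_i X_ i = setT,
                forall i j, i != j -> mu (X_ i `&` X_ j) = 0%E
              & forall i, (\int[mu]_(x in X_ i) (psi i x)%:E = (m 0 i)%:E)%E]].

Definition strong_subpartitions (m : 'rV[R]_N) : set ('I_N -> set (borel X)) :=
  [set X_ | [/\ forall i, measurable (X_ i),
                \bigcup_i X_ i `<=` setT,
                forall i j, i != j -> mu (X_ i `&` X_ j) = 0%E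
              & forall i, (\int[mu]_(x in X_ i) (psi i x)%:E = (m 0 i)%:E)%E]].

Definition partition_set : set 'rV[R]_N :=
  [set m | strong_partitions m !=set0].

Definition subpartition_set : set 'rV[R]_N :=
  [set m | strong_subpartitions m !=set0].

Definition weak_partitions (m : 'rV[R]_N) :
    set ('I_N -> {measure set (borel X) -> \bar R}) :=
  [set nu |
    (forall A : set (borel X), measurable A ->
      (\sum_(i < N) nu i A = mu A)%E) /\
    (forall i, (\int[nu i]_x (psi i x)%:E = (m 0 i)%:E)%E)].

Definition weak_subpartitions (m : 'rV[R]_N) :
    set ('I_N -> {measure set (borel X) -> \bar R}) :=
  [set nu |
    (forall A : set (borel X), measurable A ->
      (\sum_(i < N) nu i A <= mu A)%E) /\
    (forall i, (\int[nu i]_x (psi i x)%:E = (m 0 i)%:E)%E)].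

Definition objective (nu : 'I_N -> {measure set (borel X) -> \bar R}) : \bar R :=
  (\sum_(i < N) \int[nu i]_x (phi i x)%:E)%E.

Definition maximizers (W : set ('I_N -> {measure set (borel X) -> \bar R})) :
    set ('I_N -> {measure set (borel X) -> \bar R}) :=
  [set nu | W nu /\ forall nu', W nu' -> (objective nu' <= objective nu)%E].

(* A term of type [{measure set _ -> \bar R}] also assigns (meaningless) values
   to non-measurable sets, so measures are compared on Borel sets only. *)
Definition same_measures (nu nu' : 'I_N -> {measure set (borel X) -> \bar R}) :
    Prop :=
  forall i (A : set (borel X)), measurable A -> nu i A = nu' i A.

Definition is_strong (P : set ('I_N -> set (borel X)))
    (nu : 'I_N -> {measure set (borel X) -> \bar R}) : Prop :=
  exists2 X_, P X_ &
    forall i (A : set (borel X)), measurable A -> nu i A = mu (A `&` X_ i).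

Definition unique_strong_maximizer
    (W : set ('I_N -> {measure set (borel X) -> \bar R}))
    (P : set ('I_N -> set (borel X))) : Prop :=
  exists nu, [/\ maximizers W nu,
                 forall nu', maximizers W nu' -> same_measures nu' nu
               & is_strong P nu].

Definition condition_A : Prop :=
  forall i j : 'I_N, i != j -> forall a b : R,
    mu [set x | a * psi i x - b * psi j x + phi i x - phi j x = 0] = 0%E.

Definition condition_B : Prop :=
  forall (i : 'I_N) (a : R), mu [set x | phi i x = a * psi i x] = 0%E.

Definition condition_C : Prop :=
  (forall (i : 'I_N) (x : X), 0 < psi i x) /\
  (forall i j : 'I_N, i != j -> forall a b : R, 0 < a ^+ 2 + b ^+ 2 ->
    mu [set x | a * psi i x + b * psi j x = 0] = 0%E).

End partitions.

(* Main.v *)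
Require Import Defs.
From HB Require Import structures.
From mathcomp Require Import all_boot all_order all_algebra.
From mathcomp Require Import all_classical all_reals all_analysis.
From mathcomp Require Import measurable_realfun ring.

Set Implicit Arguments.
Unset Strict Implicit.
Unset Printing Implicit Defensive.

Import Order.TTheory GRing.Theory Num.Theory.
Import numFieldNormedType.Exports.

Local Open Scope classical_set_scope.
Local Open Scope ring_scope.

(** The theorem is an instance of Lagrangian duality for a linear program over
tuples of measures.

Subpartitions become partitions by adding the slack measure [mu - \sum_i nu i]
as a further entry with [phi = psi = 0]. So let the index set be [option 'I_n],
with [None] for the slack, and let [A] be the set of indices whose measure may
be nonzero. To a vector [p] of prices attach the scores [phi_i + p_i psi_i]
(and [0] for the slack), their maximum [M_p] over [A], and the dual function
[dual phi p = \int M_p dmu - \sum_i p_i m_i].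

Weak duality: a feasible tuple [nu] has payoff [\sum_k \int (score_k) dnu_k]
minus [\sum_i p_i m_i], hence at most [dual phi p]. Equality forces each [nu_k]
to live on the cell where its score attains [M_p] ([slackness]); when cells
overlap in null sets only, this means that [nu_k] is the restriction of [mu] to
its cell ([optimal_split_unique]).

Conditions (A) and (B) say that two scores agree on a null set only, for every
[p], so cells overlap in null sets. At a minimizer [p] of the convex function
[dual phi] the cells then satisfy the moment constraints, because the
derivative of [dual phi] in the direction [i] is the integral of [psi_i] over
the cell of [i] minus [m_i] ([first_order]). So a minimizer yields the strong,
unique optimum ([minimizer_strong_optimum]).

A minimizer exists when [dual no_payoff], the positively homogeneous part of
the dual, is positive away from [0], since then [dual phi] is coercive. If [m]
is an interior point this positivity is immediate: test weak duality on a tuple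
for a point [m + t p] near [m] ([near_feasible_dual_gt0]).

For a boundary point the other possibility is [dual no_payoff p <= 0] with [p
!= 0]. Every feasible tuple is then optimal for the payoff [0] and the scores
[p_i psi_i], so slackness applies to it. Under condition (C) ties between these
scores are null except between indices of price [0]. Either no such index is
ever at the top, and there is only one feasible tuple, which is strong; or the
maximum is [0] everywhere, every index with negative price is unused, and
induction on the cardinality of [A] applies ([strong_optimum_exists]). *)

(** * Integrals of bounded functions *)

Section bounded_functions.
Context d (T : measurableType d) (R : realType).
Implicit Types (f g : T -> R) (mu nu : {measure set T -> \bar R}).

Definition bounded_mfun f :=
  measurable_fun setT f /\ exists C : R, forall x, `|f x| <= C.

Lemma bounded_mfun_cst (c : R) : bounded_mfun (fun=> c).
Proof. by split; [exact: measurable_cst | exists `|c|]. Qed.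

Lemma bounded_mfunD f g : bounded_mfun f -> bounded_mfun g ->
  bounded_mfun (fun x => f x + g x).
Proof.
move=> [mf [C fC]] [mg [E gE]]; split; first exact: measurable_funD.
by exists (C + E) => x; rewrite (le_trans (ler_normD _ _))// lerD.
Qed.

Lemma bounded_mfunZ (c : R) f : bounded_mfun f ->
  bounded_mfun (fun x => c * f x).
Proof.
move=> [mf [C fC]]; split; first exact: measurable_funM.
by exists (`|c| * C) => x; rewrite normrM ler_wpM2l.
Qed.

Lemma bounded_mfunB f g : bounded_mfun f -> bounded_mfun g ->
  bounded_mfun (fun x => f x - g x).
Proof.
move=> [mf [C fC]] [mg [E gE]]; split; first exact: measurable_funB.
by exists (C + E) => x; rewrite (le_trans (ler_normB _ _))// lerD.
Qed.

Lemma bounded_mfun_max f g : bounded_mfun f -> bounded_mfun g ->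
  bounded_mfun (fun x => Num.max (f x) (g x)).
Proof.
move=> [mf [C fC]] [mg [E gE]]; split; first exact: measurable_maxr.
exists (C + E) => x; rewrite maxEle; case: ifP => _.
- by rewrite (le_trans (gE x))// lerDr (le_trans (normr_ge0 _) (fC x)).
- by rewrite (le_trans (fC x))// lerDl (le_trans (normr_ge0 _) (gE x)).
Qed.

Lemma bounded_mfun_indic (A : set T) f : measurable A -> bounded_mfun f ->
  bounded_mfun (fun x => f x * \1_A x).
Proof.
move=> mA [mf [C fC]]; split.
  by apply: measurable_funM => //; exact: measurable_indic.
exists C => x; rewrite normrM indicE; case: (x \in A).
- by rewrite normr1 mulr1.
- by rewrite normr0 mulr0 (le_trans (normr_ge0 _) (fC x)).
Qed.

Lemma bounded_mfun_integrable nu f : (nu setT < +oo)%E -> bounded_mfun f ->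
  nu.-integrable setT (EFin \o f).
Proof.
move=> nufin [mf [C fC]]; apply: measurable_bounded_integrable => //.
exists C; split; first exact: num_real.
by move=> r Cr x _ /=; rewrite (le_trans (fC x))// ltW.
Qed.

Lemma bounded_integralE nu f : (nu setT < +oo)%E -> bounded_mfun f ->
  (\int[nu]_x (f x)%:E = (\int[nu]_x f x)%:E)%E.
Proof.
move=> nufin bf; rewrite /Rintegral fineK//.
exact: integrable_fin_num (bounded_mfun_integrable nufin bf).
Qed.

Lemma bounded_integralD nu f g : (nu setT < +oo)%E ->
  bounded_mfun f -> bounded_mfun g ->
  \int[nu]_x (f x + g x) = \int[nu]_x f x + \int[nu]_x g x.
Proof.
by move=> nufin bf bg; apply: RintegralD => //; exact: bounded_mfun_integrable.
Qed.

Lemma bounded_integralB nu f g : (nu setT < +oo)%E ->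
  bounded_mfun f -> bounded_mfun g ->
  \int[nu]_x (f x - g x) = \int[nu]_x f x - \int[nu]_x g x.
Proof.
by move=> nufin bf bg; apply: RintegralB => //; exact: bounded_mfun_integrable.
Qed.

Lemma bounded_integralZ nu (c : R) f : (nu setT < +oo)%E -> bounded_mfun f ->
  \int[nu]_x (c * f x) = c * \int[nu]_x f x.
Proof.
by move=> nufin bf; apply: RintegralZl => //; exact: bounded_mfun_integrable.
Qed.

Lemma le_bounded_integral nu f g : (nu setT < +oo)%E ->
  bounded_mfun f -> bounded_mfun g -> (forall x, f x <= g x) ->
  \int[nu]_x f x <= \int[nu]_x g x.
Proof.
move=> nufin bf bg fg.
by apply: le_Rintegral => //; exact: bounded_mfun_integrable.
Qed.

Lemma measurable_set_le f g : bounded_mfun f -> bounded_mfun g ->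
  measurable [set x | f x <= g x].
Proof.
move=> [mf _] [mg _]; rewrite -[X in measurable X]setTI.
exact: measurable_fun_le.
Qed.

Lemma measurable_set_lt f g : bounded_mfun f -> bounded_mfun g ->
  measurable [set x | f x < g x].
Proof.
move=> bf bg; rewrite (_ : [set x | _] = ~` [set x | g x <= f x]).
  exact/measurableC/measurable_set_le.
by apply/seteqP; split => x /=; rewrite ltNge => /negP.
Qed.

Lemma measurable_set_eq f g : bounded_mfun f -> bounded_mfun g ->
  measurable [set x | f x = g x].
Proof.
move=> bf bg.
rewrite (_ : [set x | _] = [set x | f x <= g x] `&` [set x | g x <= f x]).
  by apply: measurableI; exact: measurable_set_le.
apply/seteqP; split => x /= => [->|[fg gf]]; first by rewrite lexx.
by apply/eqP; rewrite eq_le fg.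
Qed.

Lemma Rintegral_null nu f : nu setT = 0%E -> bounded_mfun f ->
  \int[nu]_x f x = 0.
Proof.
move=> nu0 bf; rewrite /Rintegral (@negligible_integral _ _ _ _ _ setT)//.
- by rewrite setDv integral_set0.
- by apply: bounded_mfun_integrable => //; rewrite nu0.
Qed.

(** Complementary slackness rests on this: it turns the equality of two integrals
into a restriction on the measures. *)
Lemma ge0_integral_eq0 nu f : (nu setT < +oo)%E ->
  bounded_mfun f -> (forall x, 0 <= f x) -> \int[nu]_x f x <= 0 ->
  nu [set x | 0 < f x] = 0%E.
Proof.
move=> nufin bf f0 int0.
have i0 : (\int[nu]_x `|(f x)%:E| = 0)%E.
  under eq_integral do rewrite gee0_abs ?lee_fin//.
  rewrite bounded_integralE//; congr EFin; apply/eqP.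
  by rewrite eq_le int0 Rintegral_ge0.
have [mf _] := bf.
have /ae_eq_integral_abs [//||N [mN N0 sub]] := i0.
  exact/measurable_EFinP.
apply: (subset_measure0 _ mN _ N0).
  by apply: (@measurable_set_lt (fun=> 0)) => //; exact: bounded_mfun_cst.
move=> x /= fx0; apply: sub => /= /(_ I) [] fxe.
by rewrite fxe ltxx in fx0.
Qed.

(** The hypothesis on [nu] is stated on measurable sets only, and without
[mrestr], so that it applies to measures known to agree with a restriction
there, as in the definition of a strong partition. *)
Lemma restricted_integral mu nu (A : set T) f : (mu setT < +oo)%E ->
  measurable A -> (forall E, measurable E -> nu E = mu (E `&` A)) ->
  bounded_mfun f ->
  (\int[nu]_x (f x)%:E = \int[mu]_(x in A) (f x)%:E)%E.
Proof.
move=> mufin mA nuE bf.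
have nufin : (nu setT < +oo)%E.
  by rewrite nuE// setTI (le_lt_trans _ mufin)// le_measure ?inE.
rewrite (@negligible_integral _ _ _ _ _ (~` A))//; last 3 first.
- exact: measurableC.
- exact: bounded_mfun_integrable.
- by rewrite nuE ?setICl ?measure0//; exact: measurableC.
rewrite setTD setCK; apply: eq_measure_integral => E mE EA.
by rewrite nuE// setIidl.
Qed.

End bounded_functions.

(** * Families of measures with a given sum *)
Section splitting.
Context d (T : measurableType d) (R : realType) (K : finType).
Variable (mu : {measure set T -> \bar R}).
Hypothesis mu_fin : (mu setT < +oo)%E.
Implicit Type nu : K -> {measure set T -> \bar R}.

Definition splits nu :=
  forall E, measurable E -> (\sum_k nu k E = mu E)%E.

Lemma splits_le nu k E : splits nu -> measurable E -> (nu k E <= mu E)%E.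
Proof.
move=> snu mE; rewrite -snu// (bigD1 k)//= leeDl//.
by apply: sume_ge0 => l _; exact: measure_ge0.
Qed.

Lemma splits_fin nu k : splits nu -> (nu k setT < +oo)%E.
Proof. by move=> snu; rewrite (le_lt_trans _ mu_fin)// splits_le. Qed.

(** [msum] sums sequences indexed by [nat]; here the family is indexed by an
arbitrary finite type. *)
Lemma sum_measure nu (s : seq K) : (forall k, nu k setT < +oo)%E ->
  exists sigma : {measure set T -> \bar R}, 
   [/\ (sigma setT < +oo)%E, forall E, sigma E = (\sum_(k <- s) nu k E)%E
    & forall f : T -> R, bounded_mfun f ->
       \int[sigma]_x f x = \sum_(k <- s) \int[nu k]_x f x].
Proof.
move=> nufin; elim: s => [|k s [sigma [sfin sE sint]]].
  exists mzero; split => [|E|f bf]; [exact: ltry | by rewrite big_nil |].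
  by rewrite big_nil Rintegral_null.
exists (measure_add (nu k) sigma); split.
- by rewrite [ltLHS](measure_addE (nu k) sigma) lte_add_pinfty.
- by move=> E; rewrite big_cons -sE; exact: measure_addE.
- move=> f bf; rewrite big_cons -sint// /Rintegral integral_measure_add//.
  + by rewrite fineD//; apply: integrable_fin_num => //;
      exact: bounded_mfun_integrable.
  + exact: bounded_mfun_integrable.
  + exact: bounded_mfun_integrable.
Qed.

Lemma splits_integral nu (f : T -> R) : splits nu -> bounded_mfun f ->
  \sum_k \int[nu k]_x f x = \int[mu]_x f x.
Proof.
move=> snu bf.
have [|sigma [sfin sE <-//]] := @sum_measure nu (index_enum K).
  by move=> k; exact: splits_fin.
congr fine; apply: eq_measure_integral => E mE _; rewrite sE.
exact: snu.
Qed.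

End splitting.
(** * Upper envelopes and their cells *)
Section envelope.
Context (T : Type) (R : realType) (K : finType) (A : {set K}) (k0 : K).
Hypothesis Ak0 : k0 \in A.
Implicit Type g : K -> T -> R.

(** [R] has no least element, so the iterated maximum starts from the value at
[k0]; as [k0 \in A], this does not change the maximum over [A]. *)
Definition envelope g x := \big[Num.max/g k0 x]_(k in A) g k x.

Definition cell g k := [set x | k \in A /\ g k x = envelope g x].

Lemma le_envelope g k x : k \in A -> g k x <= envelope g x.
Proof. by move=> kA; exact: (le_bigmax_cond _ (fun k => g k x)). Qed.

Lemma envelope_attained g x : exists2 k, k \in A & g k x = envelope g x.
Proof.
rewrite /envelope; elim/big_ind: _ => [|u v [k kA ku] [l lA lv]|k kA].
- by exists k0.
- by rewrite maxEle; case: ifP => _; [exists l | exists k].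
- by exists k.
Qed.

Lemma envelope_le g x c :
  (forall k, k \in A -> g k x <= c) -> envelope g x <= c.
Proof. by move=> gc; have [k kA <-] := envelope_attained g x; exact: gc. Qed.

Lemma envelope_lip g h x e : (forall k, k \in A -> g k x <= h k x + e) ->
  envelope g x <= envelope h x + e.
Proof.
move=> gh; apply: envelope_le => k kA.
by rewrite (le_trans (gh k kA))// lerD2r le_envelope.
Qed.

Lemma bigcup_cell g : \bigcup_k cell g k = setT.
Proof.
apply/seteqP; split => // x _.
by have [k kA gk] := envelope_attained g x; exists k.
Qed.

Lemma cell_notin g k : k \notin A -> cell g k = set0.
Proof.
by move=> kA; apply/seteqP; split => // x [] /=; rewrite (negbTE kA).
Qed.

Lemma notin_cell g k x : k \in A -> ~ cell g k x -> g k x < envelope g x.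
Proof.
move=> kA gk; rewrite lt_neqAle le_envelope// andbT.
by apply/eqP => gkx; apply: gk.
Qed.

End envelope.

Section measurable_envelope.
Context d (T : measurableType d) (R : realType) (K : finType) (A : {set K}).
Variables (k0 : K) (g : K -> T -> R).
Hypothesis bg : forall k, bounded_mfun (g k).

Lemma bounded_mfun_envelope : bounded_mfun (envelope A k0 g).
Proof.
rewrite /envelope; elim: (index_enum K) => [|k s IHs].
  by under eq_fun do rewrite big_nil; exact: bg.
under eq_fun do rewrite big_cons; case: (k \in A) => //.
exact: bounded_mfun_max.
Qed.

Lemma measurable_cell k : measurable (cell A k0 g k).
Proof.
have [kA|kA] := boolP (k \in A); last by rewrite cell_notin.
rewrite (_ : cell _ _ _ _ = [set x | g k x = envelope A k0 g x]).
  exact/measurable_set_eq/bounded_mfun_envelope.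
by apply/seteqP; split => x => [[]|].
Qed.

End measurable_envelope.

Section almost_disjoint.
Context d (T : measurableType d) (R : realType) (K : eqType).
Variables (mu : {measure set T -> \bar R}) (C : K -> set T).
Hypothesis mu_fin : (mu setT < +oo)%E.
Hypothesis mC : forall k, measurable (C k).
Hypothesis C0 : forall k l, k != l -> mu (C k `&` C l) = 0%E.

Let mU (s : seq K) : measurable (\big[setU/set0]_(k <- s) C k).
Proof. by apply: bigsetU_measurable. Qed.

(** Cells cover the space and overlap in null sets; this makes the restrictions
of [mu] to them add up to [mu]. *)
Lemma measure_almost_disjoint (s : seq K) E : uniq s -> measurable E ->
  (\sum_(k <- s) mu (E `&` C k) = mu (E `&` \big[setU/set0]_(k <- s) C k))%E.
Proof.
move=> + mE; elim: s => [|k s IHs] /=.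
  by rewrite !big_nil setI0 measure0.
move=> /andP[ks us]; rewrite !big_cons IHs//.
set U := \big[setU/set0]_(l <- s) C l.
have mEC : measurable (E `&` C k) by exact: measurableI.
have CU0 : mu (C k `&` U) = 0%E.
  rewrite {}/U {IHs us}; elim: s ks => [|l s IHs].
    by rewrite big_nil setI0 measure0.
  rewrite inE negb_or => /andP[kl ks]; rewrite big_cons setIUr.
  apply: null_set_setU; [exact: measurableI | | exact: C0 | exact: IHs].
  by apply: measurableI => //; exact: mU.
have mEU : measurable (E `&` U) by apply: measurableI => //; exact: mU.
rewrite setIUr measureUfinl//; last first.
  by rewrite (le_lt_trans _ mu_fin)// le_measure ?inE.
rewrite [X in (_ - X)%E](_ : _ = 0%E) ?sube0//.
apply: (subset_measure0 _ _ _ CU0).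
- exact: measurableI.
- by apply: measurableI => //; exact: mU.
- by move=> x [[_ ?] [_ ?]].
Qed.

End almost_disjoint.

(** * Weak duality and complementary slackness *)
Section duality.
Context d (T : measurableType d) (R : realType) (K : finType).
Variables (mu : {measure set T -> \bar R}) (A : {set K}) (k0 : K).
Hypotheses (mu_fin : (mu setT < +oo)%E) (Ak0 : k0 \in A).
Variable g : K -> T -> R.
Hypothesis bg : forall k, bounded_mfun (g k).
Implicit Type nu : K -> {measure set T -> \bar R}.
Let M := envelope A k0 g.
Let bM : bounded_mfun M := bounded_mfun_envelope A k0 bg.

Definition vanishes_off nu := forall k, k \notin A -> nu k setT = 0%E.

Lemma vanishes_off_eq0 nu k E : vanishes_off nu -> k \notin A ->
  measurable E -> nu k E = 0%E.
Proof.
by move=> nuA kA mE; apply: (subset_measure0 mE measurableT _ (nuA k kA)).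
Qed.

(** Integrating the envelope against [mu] means integrating it against each of
the [nu k] and adding up, so the gap is a sum of integrals of nonnegative
functions. *)
Lemma duality_gap nu : splits mu nu ->
  \int[mu]_x M x - \sum_k \int[nu k]_x g k x =
  \sum_k \int[nu k]_x (M x - g k x).
Proof.
move=> snu; rewrite -(splits_integral mu_fin snu bM) -sumrB.
apply: eq_bigr => k _; rewrite bounded_integralB//.
exact: splits_fin snu.
Qed.

Lemma gap_ge0 nu k : splits mu nu -> vanishes_off nu ->
  0 <= \int[nu k]_x (M x - g k x).
Proof.
move=> snu nuA; have [kA|kA] := boolP (k \in A).
  by apply: Rintegral_ge0 => x _; rewrite subr_ge0 le_envelope.
by rewrite Rintegral_null//; [exact: nuA | exact: bounded_mfunB].
Qed.

Lemma weak_duality nu : splits mu nu -> vanishes_off nu ->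
  \sum_k \int[nu k]_x g k x <= \int[mu]_x M x.
Proof.
move=> snu nuA; rewrite -subr_ge0 duality_gap//.
by apply: sumr_ge0 => k _; exact: gap_ge0.
Qed.

(** At zero gap each of its nonnegative summands vanishes, so [nu k] does not
charge the set where [g k] is below the envelope. *)
Lemma slackness nu k : splits mu nu -> vanishes_off nu ->
  \int[mu]_x M x <= \sum_k \int[nu k]_x g k x ->
  nu k (~` cell A k0 g k) = 0%E.
Proof.
move=> snu nuA opt.
have [kA|kA] := boolP (k \in A); last first.
  by apply: vanishes_off_eq0 => //; apply/measurableC/measurable_cell.
have bMg : bounded_mfun (fun x => M x - g k x) by exact: bounded_mfunB.
have gap0 : \int[nu k]_x (M x - g k x) <= 0.
  have : \sum_k \int[nu k]_x (M x - g k x) <= 0.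
    by rewrite -duality_gap// subr_le0.
  rewrite (bigD1 k)//=; apply: le_trans; rewrite lerDl.
  by apply: sumr_ge0 => l _; exact: gap_ge0.
have : nu k [set x | 0 < M x - g k x] = 0%E.
  apply: ge0_integral_eq0 => //; first exact: splits_fin snu.
  by move=> x; rewrite subr_ge0 le_envelope.
apply: subset_measure0.
- exact/measurableC/measurable_cell.
- by apply: (@measurable_set_lt _ _ _ (fun=> 0)) => //; exact: bounded_mfun_cst.
- by move=> x /= xk; rewrite subr_gt0; exact: notin_cell.
Qed.

Hypothesis no_ties : forall k l, k \in A -> l \in A -> k != l ->
  mu (cell A k0 g k `&` cell A k0 g l) = 0%E.

Lemma cell_ties k l : k != l -> mu (cell A k0 g k `&` cell A k0 g l) = 0%E.
Proof.
move=> kl; have [kA|kA] := boolP (k \in A); last by rewrite cell_notin// set0I.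
have [lA|lA] := boolP (l \in A); last first.
  by rewrite [X in _ `&` X]cell_notin// setI0.
exact: no_ties.
Qed.

(** On the cell of [k] the other measures vanish: each is concentrated on its own
cell and dominated by [mu], for which the overlap is null.  Hence [nu k] takes
all the mass of [mu] there. *)
Lemma optimal_split_unique nu k E : splits mu nu -> vanishes_off nu ->
  \int[mu]_x M x <= \sum_k \int[nu k]_x g k x ->
  measurable E -> nu k E = mu (E `&` cell A k0 g k).
Proof.
move=> snu nuA opt mE.
have mc l : measurable (cell A k0 g l) by exact: measurable_cell.
have mEc l : measurable (E `&` cell A k0 g l) by exact: measurableI.
rewrite -snu// (bigD1 k)//= big1 => [|l lk]; last first.
  apply/eqP; rewrite -measure_le0.
  rewrite (@le_trans _ _
    (nu l (~` cell A k0 g l `|` (cell A k0 g l `&` cell A k0 g k))))//.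
    apply: le_measure; rewrite ?inE//.
      by apply: measurableU; [exact/measurableC | exact: measurableI].
    move=> x [_ xk]; have [xl|xl] := pselect (cell A k0 g l x).
      by right.
    by left.
  apply: (@le_trans _ _ (nu l (~` cell A k0 g l) +
                         nu l (cell A k0 g l `&` cell A k0 g k))%E).
    by apply: measureU2; [exact/measurableC | exact: measurableI].
  rewrite slackness// add0e.
  by rewrite -(cell_ties lk) splits_le//; exact: measurableI.
rewrite adde0 (measureDI (nu k) mE (mc k)).
rewrite [X in (X + _)%E](_ : _ = 0%E) ?add0e//.
apply: (subset_measure0 _ _ _ (slackness k snu nuA opt)) => //.
- exact: measurableD.
- exact/measurableC.
Qed.

Lemma cells_split nu :
  (forall k E, measurable E -> nu k E = mu (E `&` cell A k0 g k)) ->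
  splits mu nu /\ vanishes_off nu.
Proof.
have mc l : measurable (cell A k0 g l) by exact: measurable_cell.
move=> nuE; split=> [E mE|k kA]; last first.
  by rewrite nuE// cell_notin// setI0 measure0.
under eq_bigr do rewrite nuE//.
rewrite measure_almost_disjoint//; [|exact: cell_ties|exact: index_enum_uniq].
rewrite -bigcup_seq (_ : \bigcup_(_ in _) _ = setT) ?setIT//.
apply/seteqP; split => // x _.
have [k kA gk] := envelope_attained Ak0 g x.
by exists k; [rewrite /= mem_index_enum | split].
Qed.

Lemma cells_optimal nu :
  (forall k E, measurable E -> nu k E = mu (E `&` cell A k0 g k)) ->
  \sum_k \int[nu k]_x g k x = \int[mu]_x M x.
Proof.
move=> nuE; have [snu nuA] := cells_split nuE.
apply/eqP; rewrite eq_sym -subr_eq0 duality_gap//; apply/eqP/big1 => k _.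
have bMg : bounded_mfun (fun x => M x - g k x) by exact: bounded_mfunB.
rewrite /Rintegral (restricted_integral mu_fin _ (nuE k) bMg); last first.
  exact: measurable_cell.
rewrite (eq_integral (cst 0%E)) ?integral0// => x; rewrite inE => -[_ gkx].
by rewrite gkx subrr.
Qed.

End duality.
(** * Minima of functions on row vectors *)
Section minimization.
Context (R : realType) (n : nat).
Implicit Types (f : 'rV[R]_n -> R) (V : set 'rV[R]_n) (p : 'rV[R]_n).

(** The one-sided form of the Lipschitz condition is what pointwise comparison of
maxima and integrals produces; it gives the two-sided one by symmetry. *)
Lemma continuous_of_lipschitz f (L : R) :
  (forall p q, f p <= f q + L * `|p - q|) -> continuous f.
Proof.
move=> fL p; apply/(@cvgrPdist_le _ _ _ (nbhs p) (nbhs_filter p)) => e e0.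
have L1 : 0 < `|L| + 1 by rewrite ltr_wpDl.
near=> q.
have pq : (`|L| + 1) * `|p - q| <= e.
  rewrite mulrC -ler_pdivlMr//; near: q.
  apply/nbhs_ballP; exists (e / (`|L| + 1)) => /=; first by rewrite divr_gt0.
  by move=> q; rewrite -ball_normE /= => /ltW.
have Lpq u v : f u - f v <= (`|L| + 1) * `|u - v|.
  rewrite lerBlDl (le_trans (fL u v))// lerD2l ler_wpM2r//.
  by rewrite (le_trans (ler_norm L))// lerDl.
by rewrite ler_norml lerNl opprB !(le_trans _ pq)//= distrC.
Unshelve. all: by end_near. Qed.

Lemma closed_norm_le (c : R) : closed [set p : 'rV[R]_n | `|p| <= c].
Proof.
apply: (@preimage_closed _ _ (fun p : 'rV[R]_n => `|p|) [set x | x <= c]).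
  by move=> p _; exact: norm_continuous.
exact: closed_le.
Qed.

Lemma closed_norm_ge (c : R) : closed [set p : 'rV[R]_n | c <= `|p|].
Proof.
apply: (@preimage_closed _ _ (fun p : 'rV[R]_n => `|p|) [set x | c <= x]).
  by move=> p _; exact: norm_continuous.
exact: closed_ge.
Qed.

Lemma min_on_bounded V f c : closed V -> continuous f ->
  (forall p, V p -> `|p| <= c) -> V !=set0 ->
  exists2 p, V p & forall q, V q -> f p <= f q.
Proof.
move=> cV cf Vc V0.
have kV : compact V.
  apply: bounded_closed_compact => //; exists c; split; first exact: num_real.
  by move=> x cx p /Vc pc /=; rewrite (le_trans pc)// ltW.
have [|p] := compact_EVT_min V0 kV (f := f).
  exact: continuous_subspaceT.
by rewrite inE => Vp minp; exists p => // q Vq; apply: minp; rewrite inE.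
Qed.

Lemma coercive_attains_min V f (r C : R) : closed V -> V 0 ->
  continuous f -> 0 < r -> (forall p, V p -> r * `|p| - C <= f p) ->
  exists2 p, V p & forall q, V q -> f p <= f q.
Proof.
move=> cV V0 cf r0 fr; pose c := (f 0 + C) / r.
have c0 : 0 <= c.
  rewrite divr_ge0 ?(ltW r0)// -lerBlDr sub0r.
  by have := fr 0 V0; rewrite normr0 mulr0 add0r.
have [||||p [Vp pc] minp] := @min_on_bounded (V `&` [set p | `|p| <= c]) f c.
- by apply: closedI => //; exact: closed_norm_le.
- exact: cf.
- by move=> p [].
- by exists 0; split => //=; rewrite normr0.
exists p => // q Vq; have [qc|cq] := leP `|q| c; first exact: minp.
apply: le_trans (fr q Vq); apply: (@le_trans _ _ (f 0)).
  by apply: minp; split => //=; rewrite normr0.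
by rewrite lerBrDr mulrC -ler_pdivrMr// ltW.
Qed.

(** By homogeneity the sign and the growth of [f] are decided on the unit sphere,
which is compact: if [f] is positive there, its minimum is the rate [r]. *)
Lemma homogeneous_alternative V f : closed V ->
  (forall p (t : R), V p -> 0 < t -> V (t *: p)) ->
  continuous f -> f 0 = 0 ->
  (forall p (t : R), 0 < t -> f (t *: p) = t * f p) ->
  (exists p, [/\ V p, p != 0 & f p <= 0]) \/
  (exists2 r : R, 0 < r & forall p, V p -> r * `|p| <= f p).
Proof.
move=> cV sV cf f0 hf.
have [|no] := pselect (exists p, [/\ V p, p != 0 & f p <= 0]); first by left.
right.
pose S := V `&` ([set p | `|p| <= 1] `&` [set p | 1 <= `|p|]).
have toS p : V p -> p != 0 -> S (`|p|^-1 *: p).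
  move=> Vp p0; have np : 0 < `|p| by rewrite normr_gt0.
  split; first by apply: sV => //; rewrite invr_gt0.
  by rewrite /= normrZ normfV normr_id mulVf ?gt_eqF.
have [S0|S0] := pselect (S !=set0); last first.
  (* the cone V is trivial, and any rate will do *)
  exists 1 => // p Vp; have [->|p0] := eqVneq p 0.
    by rewrite normr0 mulr0 f0.
  by exfalso; apply: S0; eexists; exact: toS p0.
have [||||c Sc minc] := @min_on_bounded S f 1 => //.
- apply: closedI => //.
  by apply: closedI; [exact: closed_norm_le | exact: closed_norm_ge].
- by move=> p [_ []].
have fc : 0 < f c.
  rewrite ltNge; apply/negP => fc; apply: no; exists c; split => //.
    by case: Sc.
  by apply: contraPneq Sc => -> [_ [_]] /=; rewrite normr0 ler10.
exists (f c) => // p Vp; have [->|p0] := eqVneq p 0.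
  by rewrite normr0 mulr0 f0.
have np : 0 < `|p| by rewrite normr_gt0.
have /minc := toS p Vp p0.
by rewrite hf ?invr_gt0// mulrC ler_pdivlMr.
Qed.

End minimization.
(** * The dual problem *)
Lemma big_option (V : Type) (idx : V) (op : Monoid.com_law idx) (I : finType)
    (F : option I -> V) :
  \big[op/idx]_k F k = op (F None) (\big[op/idx]_i F (Some i)).
Proof.
rewrite (bigD1 None)//=; congr (op _ _).
rewrite (reindex_omap Some id) => [|[]//].
by apply: eq_bigl => i; rewrite /= eqxx.
Qed.

Section dual_problem.
Context d (T : measurableType d) (R : realType) (n : nat).
Variable mu : {measure set T -> \bar R}.
Hypothesis mu1 : mu setT = 1%E.
Variable psi : 'I_n -> T -> R.
Hypothesis bpsi : forall i, bounded_mfun (psi i).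
Variables (A : {set option 'I_n}) (k0 : option 'I_n).
Hypothesis Ak0 : k0 \in A.
Variable m : 'rV[R]_n.
Implicit Types (phi : 'I_n -> T -> R) (p q : 'rV[R]_n).
Implicit Type nu : option 'I_n -> {measure set T -> \bar R}.

Let mu_fin : (mu setT < +oo)%E. Proof. by rewrite mu1 ltry. Qed.

(** The slack [None] has score [0]: its price multiplies the zero function. *)
Definition score phi p (k : option 'I_n) x : R :=
  if k is Some i then phi i x + p 0 i * psi i x else 0.

Definition dual phi p : R :=
  \int[mu]_x envelope A k0 (score phi p) x - \sum_i p 0 i * m 0 i.

(** The last two clauses force [m 0 i = 0] when [Some i \notin A]. *)
Definition feasible nu :=
  [/\ splits mu nu, vanishes_off A nu
    & forall i, \int[nu (Some i)]_x psi i x = m 0 i].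

Definition payoff phi nu : R := \sum_i \int[nu (Some i)]_x phi i x.

Lemma bounded_score phi p k : (forall i, bounded_mfun (phi i)) ->
  bounded_mfun (score phi p k).
Proof.
move=> bphi; case: k => [i|] /=; last exact: bounded_mfun_cst.
by apply: bounded_mfunD => //; exact: bounded_mfunZ.
Qed.

Lemma payoff_score phi p nu : (forall i, bounded_mfun (phi i)) -> feasible nu ->
  \sum_k \int[nu k]_x score phi p k x = payoff phi nu + \sum_i p 0 i * m 0 i.
Proof.
move=> bphi [snu nuA num]; have nufin k := splits_fin mu_fin k snu.
rewrite big_option /= Rintegral_cst// mul0r add0r -big_split/=.
apply: eq_bigr => i _; rewrite bounded_integralD//; last exact: bounded_mfunZ.
by rewrite bounded_integralZ// num.
Qed.

Lemma bounded_family_bound phi : (forall i, bounded_mfun (phi i)) ->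
  exists2 C : R, 0 <= C & forall i x, `|phi i x| <= C.
Proof.
move=> bphi.
have /choice[C phiC] : forall i, exists C, forall x, `|phi i x| <= C.
  by move=> i; case: (bphi i).
exists (\sum_i `|C i|); first by apply: sumr_ge0.
move=> i x; rewrite (le_trans (phiC i x))// (le_trans (ler_norm _))//.
by rewrite (bigD1 i)//= lerDl sumr_ge0.
Qed.

Lemma Rintegral_cst1 (c : R) : \int[mu]_x c = c.
Proof. by rewrite Rintegral_cst// mu1 mulr1. Qed.

Lemma ler_coord_norm p i : `|p 0 i| <= `|p|.
Proof.
rewrite [leRHS]/Num.norm /= mx_normrE; apply/bigmax_geP; right.
by exists (0, i).
Qed.

Lemma envelope_integral_lip (g h : option 'I_n -> T -> R) (e : R) :
  (forall k, bounded_mfun (g k)) -> (forall k, bounded_mfun (h k)) ->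
  (forall k x, k \in A -> g k x <= h k x + e) ->
  \int[mu]_x envelope A k0 g x <= \int[mu]_x envelope A k0 h x + e.
Proof.
move=> bg bh gh; have be := bounded_mfun_cst T e.
rewrite -[X in _ <= _ + X]Rintegral_cst1 -bounded_integralD//; last first.
  exact: bounded_mfun_envelope.
apply: le_bounded_integral => //.
- exact: bounded_mfun_envelope.
- by apply: bounded_mfunD => //; exact: bounded_mfun_envelope.
- by move=> x; apply: envelope_lip => // k kA; exact: gh.
Qed.

(** The maximum of finitely many functions is as Lipschitz in [p] as they are. *)
Lemma dual_continuous phi : (forall i, bounded_mfun (phi i)) ->
  continuous (dual phi).
Proof.
move=> bphi; have [C C0 psiC] := bounded_family_bound bpsi.
apply: (@continuous_of_lipschitz _ _ _ (C + \sum_i `|m 0 i|)) => p q.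
rewrite /dual mulrDl addrACA lerD//.
  apply: envelope_integral_lip => [k|k|[i|] x _] /=; try exact: bounded_score.
    rewrite -addrA lerD2l -lerBlDl -mulrBl.
    rewrite (le_trans (ler_norm _))// normrM mulrC ler_pM//.
    by have := ler_coord_norm (p - q) i; rewrite !mxE.
  by rewrite add0r mulr_ge0.
rewrite -lerBlDl opprK addrC.
rewrite -sumrB mulr_suml ler_sum// => i _; rewrite -mulrBl.
rewrite (le_trans (ler_norm _))// normrM mulrC ler_wpM2l// distrC.
by have := ler_coord_norm (p - q) i; rewrite !mxE.
Qed.

(** Prices of indices outside [A] do not enter [dual phi] when [m] is supported
on [A], so [dual phi] is coercive at best on this subspace. *)
Definition supported_on p := forall i, Some i \notin A -> p 0 i = 0.

Lemma closed_supported_on : closed supported_on.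
Proof.
pose F i := [set p : 'rV[R]_n | Some i \notin A -> p 0 i = 0].
rewrite (_ : supported_on = \bigcap_i F i); last first.
  by apply/seteqP; split => [p ap i _ /=|p ap i]; [exact: ap | exact: (ap i I)].
apply: closed_bigI => i _; have [iA|iA] := boolP (Some i \in A).
  rewrite (_ : F i = setT); first exact: closedT.
  by apply/seteqP; split => // p _; rewrite /F /= iA.
rewrite (_ : F i = (fun p : 'rV[R]_n => p 0 i) @^-1` [set 0]); last first.
  by apply/seteqP; split => p; rewrite /F /=; [exact | move=> -> _].
apply: preimage_closed; last exact: closed_eq.
by move=> p _; exact: coord_continuous.
Qed.

Lemma supported_on0 : supported_on 0. Proof. by move=> i _; rewrite mxE. Qed.

Lemma supported_onZ p (t : R) : supported_on p -> supported_on (t *: p).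
Proof. by move=> ap i /ap pi; rewrite mxE pi mulr0. Qed.

(** With the payoff [0] the dual function is positively homogeneous: it is the
support function of the set of attainable moments minus the linear form [m]. *)
Definition no_payoff : 'I_n -> T -> R := fun _ _ => 0.

Lemma bounded_no_payoff i : bounded_mfun (no_payoff i).
Proof. exact: bounded_mfun_cst. Qed.

Lemma envelopeZ (t : R) (g : option 'I_n -> T -> R) x : 0 <= t ->
  envelope A k0 (fun k y => t * g k y) x = t * envelope A k0 g x.
Proof.
move=> t0; apply/eqP; rewrite eq_le; apply/andP; split.
  by apply: envelope_le => // k kA; rewrite ler_wpM2l// le_envelope.
have [k kA <-] := envelope_attained Ak0 g x.
exact: (le_envelope _ (fun k y => t * g k y)).
Qed.

Lemma dual_no_payoffZ p (t : R) : 0 <= t ->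
  dual no_payoff (t *: p) = t * dual no_payoff p.
Proof.
move=> t0; rewrite /dual mulrBr; congr (_ - _); last first.
  by rewrite mulr_sumr; apply: eq_bigr => i _; rewrite mxE mulrA.
rewrite -bounded_integralZ//; last first.
  apply: bounded_mfun_envelope => k; apply: bounded_score => i.
  exact: bounded_no_payoff.
congr fine; apply: eq_integral => x _; congr EFin; rewrite -envelopeZ//.
congr (envelope A k0 _ x); apply/funext => k; apply/funext => y.
case: k => [i|] /=; last by rewrite mulr0.
by rewrite mxE !add0r mulrA.
Qed.

Lemma dual_no_payoff0 : dual no_payoff 0 = 0.
Proof. by rewrite -(scale0r (0 : 'rV[R]_n)) dual_no_payoffZ// mul0r. Qed.

(** Replacing the payoff [phi] by [0] changes the dual function by a bounded
amount, so linear growth of [dual no_payoff] makes [dual phi] coercive. *)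
Lemma dual_alternative phi : (forall i, bounded_mfun (phi i)) ->
  (exists p, [/\ supported_on p, p != 0 & dual no_payoff p <= 0]) \/
  (exists2 p, supported_on p &
    forall q, supported_on q -> dual phi p <= dual phi q).
Proof.
move=> bphi; have [|||||alt|[r r0 coer]] :=
    @homogeneous_alternative _ _ supported_on (dual no_payoff); last 2 first.
- by left.
- right; have [C C0 phiC] := bounded_family_bound bphi.
  apply: (@coercive_attains_min _ _ supported_on (dual phi) r C) => //.
  + exact: closed_supported_on.
  + exact: supported_on0.
  + exact: dual_continuous.
  + move=> p /coer; rewrite lerBlDr; move/le_trans; apply.
    rewrite /dual addrAC lerD2r.
    apply: envelope_integral_lip => [k|k|[i|] x _] /=.
    * by apply: bounded_score => i; exact: bounded_no_payoff.
    * exact: bounded_score.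
    * rewrite add0r -addrA addrCA lerDl -lerBlDr sub0r.
      by have := phiC i x; rewrite ler_norml => /andP[].
    * by rewrite add0r.
- exact: closed_supported_on.
- by move=> p t ap _; exact: supported_onZ.
- by apply: dual_continuous => i; exact: bounded_no_payoff.
- exact: dual_no_payoff0.
- by move=> p t t0; apply: dual_no_payoffZ; exact: ltW.
Qed.

Definition shift p (i : 'I_n) (t : R) : 'rV[R]_n := p + t *: delta_mx 0 i.

Lemma shift_coord p i t j : shift p i t 0 j = p 0 j + t * (j == i)%:R.
Proof. by rewrite !mxE. Qed.

Lemma supported_on_shift p i t :
  Some i \in A -> supported_on p -> supported_on (shift p i t).
Proof.
move=> iA ap j jA; rewrite shift_coord ap// add0r.
by have [ji|] := eqVneq j i; rewrite ?mulr0//; move: jA; rewrite ji iA.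
Qed.

Lemma score_shift phi p i t x :
  score phi (shift p i t) (Some i) x = score phi p (Some i) x + t * psi i x.
Proof. by rewrite /= shift_coord eqxx mulr1 mulrDl addrA. Qed.

Lemma score_shift_neq phi p i t k x : k != Some i ->
  score phi (shift p i t) k x = score phi p k x.
Proof.
case: k => [j|//] ji; rewrite /= shift_coord.
rewrite (_ : j == i = false) ?mulr0 ?addr0//.
by apply/negbTE; apply: contraNneq ji => ->.
Qed.

Definition supply phi p (i : 'I_n) : R :=
  \int[mu]_x (psi i x * \1_(cell A k0 (score phi p) (Some i)) x).

Lemma bounded_cell_psi phi p i : (forall i, bounded_mfun (phi i)) ->
  bounded_mfun (fun x => psi i x * \1_(cell A k0 (score phi p) (Some i)) x).
Proof.
move=> bphi; apply: bounded_mfun_indic => //; apply: measurable_cell => k.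
exact: bounded_score.
Qed.

(** The cell on the right is that of the shifted prices.  This makes the estimate
valid for both signs of [t]: if another index is maximal after the shift, its
score has not moved. *)
Lemma envelope_shift phi p i t x : Some i \in A ->
  envelope A k0 (score phi (shift p i t)) x <= envelope A k0 (score phi p) x +
    t * (psi i x * \1_(cell A k0 (score phi (shift p i t)) (Some i)) x).
Proof.
move=> iA.
have [ix|ix] := pselect (cell A k0 (score phi (shift p i t)) (Some i) x).
  rewrite indicE mem_set// mulr1; case: ix => _ <-.
  by rewrite score_shift lerD2r le_envelope.
rewrite indicE memNset// !mulr0 addr0.
have [k kA gk] := envelope_attained Ak0 (score phi (shift p i t)) x.
rewrite -gk score_shift_neq ?le_envelope//.
by apply: contra_notN ix => /eqP <-.
Qed.

Lemma dual_shift phi p i t : (forall i, bounded_mfun (phi i)) -> Some i \in A ->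
  dual phi (shift p i t) <=
    dual phi p + t * (supply phi (shift p i t) i - m 0 i).
Proof.
move=> bphi iA; have bs := bounded_cell_psi (shift p i t) i bphi.
have be q : bounded_mfun (envelope A k0 (score phi q)).
  by apply: bounded_mfun_envelope => k; exact: bounded_score.
have mE : \sum_j shift p i t 0 j * m 0 j = \sum_j p 0 j * m 0 j + t * m 0 i.
  under eq_bigr do rewrite shift_coord mulrDl.
  rewrite big_split/=; congr (_ + _).
  rewrite (bigD1 i)//= eqxx mulr1 big1 ?addr0// => j /negbTE ->.
  by rewrite mulr0 mul0r.
rewrite /dual mE opprD mulrBr addrACA lerD2r.
rewrite -bounded_integralZ// -bounded_integralD//; last exact: bounded_mfunZ.
apply: le_bounded_integral => //; last by move=> x; exact: envelope_shift.
by apply: bounded_mfunD => //; exact: bounded_mfunZ.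
Qed.

(** Away from ties the score of [Some i] differs from the largest score of the
other indices, and keeps its position under small shifts. *)
Lemma untied_cell_stable phi p i (t_ : R^nat) x : Some i \in A ->
  t_ @ \oo --> (0 : R) ->
  (forall k l, k \in A -> l \in A -> k != l ->
    ~ (cell A k0 (score phi p) k `&` cell A k0 (score phi p) l) x) ->
  \forall N \near \oo, 
    (\1_(cell A k0 (score phi (shift p i (t_ N))) (Some i)) x : R) =
    \1_(cell A k0 (score phi p) (Some i)) x.
Proof.
move=> iA t0 untied.
have shifted : (fun N => score phi (shift p i (t_ N)) (Some i) x) @ \oo -->
    score phi p (Some i) x.
  under eq_fun do rewrite score_shift.
  have : (fun N => score phi p (Some i) x + t_ N * psi i x) @ \oo -->
      score phi p (Some i) x + 0 * psi i x.
    by apply: cvgD; [exact: cvg_cst | apply: cvgM => //; exact: cvg_cst].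
  by rewrite mul0r addr0.
have [ix|ix] := pselect (cell A k0 (score phi p) (Some i) x).
- have lt k : k \in A -> k != Some i ->
      score phi p k x < score phi p (Some i) x.
    move=> kA ki; case: (ix) => _ ->; apply: notin_cell => // kx.
    by apply: (untied _ _ kA iA ki).
  have : \forall N \near \oo, forall k : option 'I_n, k \in A -> k != Some i ->
      score phi p k x < score phi (shift p i (t_ N)) (Some i) x.
    apply: (@filter_forall _ _ (fun k N => k \in A -> k != Some i ->
      score phi p k x < score phi (shift p i (t_ N)) (Some i) x)) => k.
    have [kA|kA] := boolP (k \in A); last exact: nearW.
    have [ki|ki] := eqVneq k (Some i); first exact: nearW.
    by apply: (filterS _ (cvgr_gt _ shifted _ (lt k kA ki))) => N ? _ _.
  move=> near_lt; apply: (filterS _ near_lt) => N kN.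
  rewrite !indicE (mem_set ix) mem_set//; split => //.
  have [k kA kE] := envelope_attained Ak0 (score phi (shift p i (t_ N))) x.
  have [ki|ki] := eqVneq k (Some i); first by rewrite -kE ki.
  have := kN k kA ki; rewrite -(score_shift_neq phi p (t_ N) x ki) kE.
  by rewrite ltNge le_envelope.
- have [k kA kE] := envelope_attained Ak0 (score phi p) x.
  have ki : k != Some i by apply: contra_notN ix => /eqP <-.
  have ik : score phi p (Some i) x < score phi p k x.
    by rewrite kE; exact: notin_cell.
  apply: (filterS _ (cvgr_lt _ shifted _ ik)) => N ltk.
  rewrite !indicE (memNset ix) memNset// => -[_ iE].
  have := le_envelope k0 (score phi (shift p i (t_ N))) x kA.
  by rewrite -iE score_shift_neq// leNgt ltk.
Qed.

(** Only ties at the level of the envelope matter; ties below it are allowed. *)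
Definition tie_free (g : option 'I_n -> T -> R) :=
  forall k l, k \in A -> l \in A -> k != l ->
    mu (cell A k0 g k `&` cell A k0 g l) = 0%E.

(** Dominated convergence: the integrand converges off the ties, a null set. *)
Lemma supply_cvg phi p i (t_ : R^nat) : (forall i, bounded_mfun (phi i)) ->
  Some i \in A -> tie_free (score phi p) -> t_ @ \oo --> (0 : R) ->
  (fun N => supply phi (shift p i (t_ N)) i) @ \oo --> supply phi p i.
Proof.
move=> bphi iA ties t0.
pose f q x := psi i x * \1_(cell A k0 (score phi q) (Some i)) x.
have bf q : bounded_mfun (f q) by exact: bounded_cell_psi.
have mf q : measurable_fun setT (EFin \o f q).
  by apply/measurable_EFinP; case: (bf q).
have [C C0 psiC] := bounded_family_bound bpsi.
have untied : {ae mu, forall x, forall kl : option 'I_n * option 'I_n,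
    kl.1 \in A -> kl.2 \in A -> kl.1 != kl.2 ->
    ~ (cell A k0 (score phi p) kl.1 `&` cell A k0 (score phi p) kl.2) x}.
  apply: (@filter_forall _ _ (fun kl x => kl.1 \in A -> kl.2 \in A ->
    kl.1 != kl.2 -> ~ (cell A k0 (score phi p) kl.1 `&`
                       cell A k0 (score phi p) kl.2) x)) => -[k l] /=.
  have [kA|kA] := boolP (k \in A); last exact: aeW.
  have [lA|lA] := boolP (l \in A); last exact: aeW.
  have [kl|kl] := eqVneq k l; first exact: aeW.
  exists (cell A k0 (score phi p) k `&` cell A k0 (score phi p) l); split.
  - by apply: measurableI; apply: measurable_cell => ?; exact: bounded_score.
  - exact: ties.
  - by move=> x /= /not_implyP[_] /not_implyP[_] /not_implyP[_] /contrapT.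
have [//|//||||_ _ cv] := @dominated_convergence _ _ _ mu setT measurableT
  (fun N => EFin \o f (shift p i (t_ N))) (EFin \o f p) (fun=> C%:E).
- apply: filterS untied => x ux _.
  apply: cvg_near_cst.
  have := @untied_cell_stable phi p i t_ x iA t0 (fun k l => ux (k, l)).
  by move=> near_eq; apply: (filterS _ near_eq) => N eqN; rewrite /= /f eqN.
- by apply: bounded_mfun_integrable => //; exact: bounded_mfun_cst.
- apply: aeW => x N _; rewrite lee_fin normrM indicE.
  by case: (_ \in _); rewrite ?normr1 ?normr0 ?mulr1 ?mulr0.
have fpE := bounded_integralE mu_fin (bf p).
by rewrite [X in _ --> X]fpE in cv; have /fine_cvgP[] := cv.
Qed.

(** By [dual_shift] and minimality, [supply] at [p + t e_i] is at least [m_i] for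
[t > 0] and at most [m_i] for [t < 0]; let [t] tend to [0] from both sides. *)
Lemma first_order phi p i : (forall i, bounded_mfun (phi i)) ->
  supported_on p -> (forall q, supported_on q -> dual phi p <= dual phi q) ->
  tie_free (score phi p) -> Some i \in A -> supply phi p i = m 0 i.
Proof.
move=> bphi ap minp ties iA.
have ge t : 0 <= t * (supply phi (shift p i t) i - m 0 i).
  have := minp _ (supported_on_shift t iA ap).
  move/le_trans/(_ (dual_shift p t bphi iA)).
  by rewrite lerDl.
have h0 (c : R) : (fun N => c * harmonic N) @ \oo --> (0 : R).
  have : (fun N => c * harmonic N) @ \oo --> c * 0.
    by apply: cvgM; [exact: cvg_cst | exact: cvg_harmonic].
  by rewrite mulr0.
have t_gt0 N : 0 < harmonic N :> R by rewrite /= invr_gt0.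
apply/eqP; rewrite eq_le; apply/andP; split.
- apply: (closed_cvg (fun x => x <= m 0 i) _ _ _
    (supply_cvg bphi iA ties (h0 (-1)))).
    exact: closed_le.
  apply: nearW => N; have := ge (-1 * harmonic N).
  by rewrite mulN1r mulNr oppr_ge0 pmulr_rle0// subr_le0.
- apply: (closed_cvg (fun x => m 0 i <= x) _ _ _
    (supply_cvg bphi iA ties (h0 1))).
    exact: closed_ge.
  apply: nearW => N; have := ge (1 * harmonic N).
  by rewrite mul1r pmulr_rge0// subr_ge0.
Qed.

(** The sets [X k] are exposed, besides the measures, since strong partitions are
tuples of sets.  The last clause contains optimality and uniqueness. *)
Definition strong_optimum phi :=
  exists nu (X : option 'I_n -> set T),
  [/\ feasible nu,
      [/\ forall k, measurable (X k), \bigcup_k X k = setT,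
          forall k l, k != l -> mu (X k `&` X l) = 0%E
        & forall k, k \notin A -> X k = set0],
      forall k E, measurable E -> nu k E = mu (E `&` X k)
    & forall nu', feasible nu' -> payoff phi nu' <= payoff phi nu /\
        (payoff phi nu <= payoff phi nu' ->
          forall k E, measurable E -> nu' k E = nu k E)].

Lemma cells_partition g : (forall k, bounded_mfun (g k)) -> tie_free g ->
  [/\ forall k, measurable (cell A k0 g k), \bigcup_k cell A k0 g k = setT,
      forall k l, k != l -> mu (cell A k0 g k `&` cell A k0 g l) = 0%E
    & forall k, k \notin A -> cell A k0 g k = set0].
Proof.
move=> bg ties; split.
- by move=> k; exact: measurable_cell.
- exact: bigcup_cell.
- by move=> k l; exact: cell_ties.
- by move=> k; exact: cell_notin.
Qed.

(** The cells at [p] are feasible by the first order condition, and attain the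
bound given by weak duality. *)
Lemma minimizer_strong_optimum phi p : (forall i, bounded_mfun (phi i)) ->
  supported_on m -> supported_on p ->
  (forall q, supported_on q -> dual phi p <= dual phi q) ->
  tie_free (score phi p) -> strong_optimum phi.
Proof.
move=> bphi am ap minp ties.
have bs k : bounded_mfun (score phi p k) by exact: bounded_score.
pose X := cell A k0 (score phi p).
have mX k : measurable (X k) by exact: measurable_cell.
pose nu k : {measure set T -> \bar R} := mrestr mu (mX k).
have nuE k E : measurable E -> nu k E = mu (E `&` X k) by [].
have [snu nuA] := cells_split mu_fin Ak0 bs ties nuE.
have fnu : feasible nu.
  split=> // i; have [iA|iA] := boolP (Some i \in A); last first.
    by rewrite am// Rintegral_null//; exact: nuA.
  rewrite -(first_order bphi ap minp ties iA) /supply /Rintegral.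
  rewrite (restricted_integral mu_fin (mX (Some i)) (nuE (Some i)))//.
  rewrite integral_mkcond; congr fine; apply: eq_integral => x _.
  rewrite patchE indicE /X; case: ifPn => xX; first by rewrite mulr1.
  by rewrite mulr0.
exists nu, X; split => // [|nu' fnu']; first exact: cells_partition.
have opt := cells_optimal mu_fin Ak0 bs ties nuE.
have := payoff_score p bphi fnu; rewrite opt => ME.
have [snu' nuA' _] := fnu'; have ME' := payoff_score p bphi fnu'.
split=> [|le k E mE].
  by have := weak_duality k0 mu_fin bs snu' nuA'; rewrite ME ME' lerD2r.
rewrite nuE//; apply: (optimal_split_unique mu_fin bs ties) => //.
by rewrite ME ME' lerD2r.
Qed.

Lemma payoff_no_payoff nu : payoff no_payoff nu = 0.
Proof. by apply: big1 => i _; rewrite Rintegral_cst// mul0r. Qed.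

(** Feasibility alone makes a tuple optimal for the scores [p_i psi_i], because
its payoff [\sum_i p_i m_i] is the same for all feasible tuples. *)
Lemma no_payoff_slack p nu : dual no_payoff p <= 0 -> feasible nu ->
  \int[mu]_x envelope A k0 (score no_payoff p) x <=
  \sum_k \int[nu k]_x score no_payoff p k x.
Proof.
move=> dp fnu; rewrite (payoff_score p bounded_no_payoff fnu).
by move: dp; rewrite payoff_no_payoff add0r subr_le0.
Qed.

(** Slackness with respect to the scores [p_i psi_i] determines feasible tuples
completely when these scores have no ties, so nothing is left to optimize. *)
Lemma singleton_strong_optimum phi p nu : dual no_payoff p <= 0 ->
  feasible nu -> tie_free (score no_payoff p) -> strong_optimum phi.
Proof.
move=> dp fnu ties.
have bs k : bounded_mfun (score no_payoff p k).
  exact/bounded_score/bounded_no_payoff.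
have nuE nu' : feasible nu' -> forall k E, measurable E ->
    nu' k E = mu (E `&` cell A k0 (score no_payoff p) k).
  move=> fnu' k E mE; have [snu' nuA' _] := fnu'.
  by apply: (optimal_split_unique mu_fin bs ties) => //; exact: no_payoff_slack.
exists nu, (cell A k0 (score no_payoff p)); split => //.
- exact: cells_partition.
- exact: nuE.
- move=> nu' fnu'.
  have same k E : measurable E -> nu' k E = nu k E.
    by move=> mE; rewrite (nuE nu')// (nuE nu).
  split=> //; rewrite le_eqVlt; apply/orP; left; apply/eqP.
  apply: eq_bigr => i _; congr fine; apply: eq_measure_integral => E mE _.
  exact: same.
Qed.

End dual_problem.
(** * Existence of a strong optimum *)
Section existence.
Context d (T : measurableType d) (R : realType) (n : nat).
Variable mu : {measure set T -> \bar R}.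
Hypothesis mu1 : mu setT = 1%E.
Variables psi phi : 'I_n -> T -> R.
Hypotheses (bpsi : forall i, bounded_mfun (psi i))
           (bphi : forall i, bounded_mfun (phi i)).
Implicit Types (A : {set option 'I_n}) (m p : 'rV[R]_n).

Let mu_fin : (mu setT < +oo)%E. Proof. by rewrite mu1 ltry. Qed.

Definition generic_scores A := forall p k l, k \in A -> l \in A -> k != l ->
  mu [set x | score psi phi p k x = score psi phi p l x] = 0%E.

Definition has_feasible A m := exists nu, feasible mu psi A m nu.

(** The hypothesis is limited to pairs of cells with a common point: indices whose
score never reaches the envelope may be tied on a set of positive measure. *)
Lemma eq_set_tie_free A k0 (g : option 'I_n -> T -> R) :
  (forall k, bounded_mfun (g k)) ->
  (forall k l x, k != l -> cell A k0 g k x -> cell A k0 g l x ->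
    mu [set x | g k x = g l x] = 0%E) -> tie_free mu A k0 g.
Proof.
move=> bg ties k l kA lA kl.
have [[x [xk xl]]|no] := pselect ((cell A k0 g k `&` cell A k0 g l) !=set0).
  apply: (subset_measure0 _ _ _ (ties k l x kl xk xl)).
  - by apply: measurableI; exact: measurable_cell.
  - exact: measurable_set_eq.
  - by move=> y [[_ ky] [_ ly]] /=; rewrite ky ly.
rewrite (_ : _ `&` _ = set0) ?measure0//.
by apply/seteqP; split => // x kx; apply: no; exists x.
Qed.

Lemma has_feasible_inhabited A m : has_feasible A m -> exists k, k \in A.
Proof.
move=> [nu [snu nuA _]]; apply: contrapT => noA.
have := mu1; rewrite -snu// big1 => [/esym /eqP|k _].
  by rewrite onee_eq0.
by apply: nuA; apply/negP => kA; apply: noA; exists k.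
Qed.

Lemma has_feasible_supported_on A m : has_feasible A m -> supported_on A m.
Proof.
move=> [nu [snu nuA num]] i iA; rewrite -num Rintegral_null//; exact: nuA.
Qed.

Lemma generic_tie_free A k0 p : generic_scores A ->
  tie_free mu A k0 (score psi phi p).
Proof.
move=> gen; apply: eq_set_tie_free => [k|k l x kl [kA _] [lA _]].
  exact: bounded_score.
exact: gen.
Qed.

(** A feasible tuple for [m + t p] has value [\sum_i p_i (m_i + t p_i)] for the
scores [p_i psi_i], which exceeds [\sum_i p_i m_i] by [t \sum_i p_i ^ 2]. *)
Lemma near_feasible_dual_gt0 A k0 m p :
  nbhs m [set m' | has_feasible A m'] -> p != 0 ->
  0 < dual mu psi A k0 m (@no_payoff _ T R n) p.
Proof.
move=> /nbhs_ballP[e /= e0 feas] p0.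
have np : 0 < `|p| by rewrite normr_gt0.
(* half the radius, so that m + t p stays in the open ball *)
pose t := e / (2 * `|p|).
have t0 : 0 < t by rewrite divr_gt0// mulr_gt0.
have [nu fnu] : has_feasible A (m + t *: p).
  apply: feas; rewrite -ball_normE /= opprD addNKr normrN normrZ gtr0_norm//.
  by rewrite /t invfM mulrA divfK ?gt_eqF// gtr_pMr// invf_lt1// ltr1n.
have [snu nuA _] := fnu.
have bs k : bounded_mfun (score psi (@no_payoff _ T R n) p k).
  by apply: bounded_score => // i; exact: bounded_no_payoff.
have := weak_duality k0 mu_fin bs snu nuA.
rewrite (payoff_score mu1 bpsi p (@bounded_no_payoff _ T R n) fnu).
rewrite payoff_no_payoff add0r => le.
rewrite /dual subr_gt0 (lt_le_trans _ le)//.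
under [ltRHS]eq_bigr do rewrite !mxE mulrDr.
rewrite big_split/= ltrDl.
have [i pi] : exists i, p 0 i != 0.
  apply: contrapT => noi; case/eqP: p0; apply/rowP => i; rewrite mxE.
  by apply: contrapT => /eqP pi; apply: noi; exists i.
rewrite (bigD1 i)//= ltr_pwDl//.
  by rewrite mulrCA mulr_gt0// -expr2 lt_neqAle sqr_ge0 andbT eq_sym sqrf_eq0.
by apply: sumr_ge0 => j _; rewrite mulrCA mulr_ge0 ?(ltW t0)// -expr2 sqr_ge0.
Qed.

Lemma interior_strong_optimum A m : generic_scores A ->
  nbhs m [set m' | has_feasible A m'] -> strong_optimum mu psi A m phi.
Proof.
move=> gen near_m; have fm : has_feasible A m by exact: nbhs_singleton near_m.
have [k0 Ak0] := has_feasible_inhabited fm.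
have [[p [_ p0 dp]]|[p ap minp]] := dual_alternative mu1 bpsi Ak0 m bphi.
  by have := near_feasible_dual_gt0 k0 near_m p0; rewrite ltNge dp.
apply: (minimizer_strong_optimum mu1 bpsi Ak0 bphi _ ap minp).
  exact: has_feasible_supported_on fm.
exact: generic_tie_free.
Qed.

Definition extended_price p (k : option 'I_n) : R :=
  if k is Some i then p 0 i else 0.

Hypothesis psi_gt0 : forall i x, 0 < psi i x.
Hypothesis psi_generic : forall i j, i != j -> forall a b : R, a != 0 ->
  mu [set x | a * psi i x = b * psi j x] = 0%E.

(** Induction on the number of usable indices.  If the dual function has no
minimizer, there are prices [p != 0] with [dual no_payoff p <= 0].  Since the
[psi i] are positive, the sign of a score is that of its price.  If no index of
price [0] is ever maximal, scores are tied on null sets only and feasible tuples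
are unique.  Otherwise the envelope is [0] everywhere, indices of negative price
are unused by slackness, and they can be removed from [A]; there are some, as
[p] is nonzero and has no positive entry. *)
Lemma strong_optimum_exists A m : generic_scores A -> has_feasible A m ->
  strong_optimum mu psi A m phi.
Proof.
have [N] := ubnP #|A|; elim: N A => // N IHN A cardA gen fA.
have [k0 Ak0] := has_feasible_inhabited fA.
have am := has_feasible_supported_on fA.
have [[p [ap p0 dp]]|[p ap minp]] :=
  dual_alternative mu1 bpsi Ak0 m bphi; last first.
  apply: (minimizer_strong_optimum mu1 bpsi Ak0 bphi am ap minp).
  exact: generic_tie_free.
have [nu0 fnu0] := fA.
pose g := score psi (@no_payoff _ T R n) p.
have bg k : bounded_mfun (g k).
  by apply: bounded_score => // i; exact: bounded_no_payoff.
have gE k x : g k x = if k is Some i then p 0 i * psi i x else 0.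
  by rewrite /g; case: k => //= i; rewrite add0r.
have [uniq_case|tied] :=
  pselect (forall k x, cell A k0 g k x -> extended_price p k != 0).
  apply: (singleton_strong_optimum mu1 bpsi Ak0 phi dp fnu0).
  apply: eq_set_tie_free => // k l x kl /uniq_case wk /uniq_case wl.
  case: k l kl wk wl => [i|] [j|] //=; rewrite ?eqxx// => ij pi pj.
  rewrite (_ : [set x | _] = [set x | p 0 i * psi i x = p 0 j * psi j x]).
    by apply: psi_generic => //; apply: contraNneq ij => ->.
  by apply/seteqP; split => y /=; rewrite !add0r.
have [k1 [x1 [k1A k1x] wk1]] :
    exists k, exists2 x, cell A k0 g k x & extended_price p k = 0.
  move/existsNP: tied => [k /existsNP[x /not_implyP[kx /negP/negPn/eqP wk]]].
  by exists k, x.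
(* the score of k1 vanishes identically; since it is maximal at x1, there are no
positive prices *)
have gk1 x : g k1 x = 0.
  by rewrite gE; move: wk1; case: (k1) => //= i ->; rewrite mul0r.
have w_le0 k : k \in A -> extended_price p k <= 0.
  move=> kA; have := le_envelope k0 g x1 kA; rewrite -k1x gk1 gE.
  by case: k kA => //= i iA; rewrite pmulr_lle0.
have g_le0 k x : k \in A -> g k x <= 0.
  by move=> /w_le0; rewrite gE; case: k => //= i; rewrite pmulr_lle0.
have M0 x : envelope A k0 g x = 0.
  apply/eqP; rewrite eq_le; apply/andP; split.
    by apply: envelope_le => // k kA; exact: g_le0.
  by rewrite -(gk1 x) le_envelope.
pose B := [set k in A | extended_price p k == 0]%SET.
have BA k : k \notin A -> k \notin B by move=> kA; rewrite inE (negbTE kA).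
have feasibleE nu : feasible mu psi A m nu <-> feasible mu psi B m nu.
  split=> [fnu|[snu nuB num]]; last by split => // k /BA; exact: nuB.
  have [snu nuA num] := fnu; split => // k; rewrite inE negb_and.
  have [kA /= wk|kA _] := boolP (k \in A); last exact: nuA.
  have := slackness mu_fin bg k snu nuA (no_payoff_slack mu1 bpsi dp fnu).
  rewrite (_ : cell _ _ _ _ = set0) ?setC0//.
  apply/seteqP; split => // x [_]; rewrite M0 -/g gE.
  case: k wk kA => [i|] /=; last by rewrite eqxx.
  by move=> pi iA /eqP; rewrite mulf_eq0 (negbTE pi) gt_eqF.
have [i pi] : exists i, p 0 i != 0.
  apply: contrapT => noi; case/eqP: p0; apply/rowP => i; rewrite mxE.
  by apply: contrapT => /eqP pi; apply: noi; exists i.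
have iA : Some i \in A by apply: contraNT pi => /ap ->.
have cardB : (#|B| < N)%N.
  move: cardA; rewrite ltnS; apply: leq_trans; apply: proper_card.
  apply/properP; split.
    by apply/fintype.subsetP => k; rewrite inE => /andP[].
  by exists (Some i) => //; rewrite inE iA.
have genB : generic_scores B.
  by move=> q k l; rewrite !inE => /andP[kA _] /andP[lA _]; exact: gen.
have fB : has_feasible B m by exists nu0; exact/feasibleE.
have [nu [X [fnu [mX coverX tiesX XB] nuE opt]]] := IHN B cardB genB fB.
exists nu, X; split => //.
- exact/feasibleE.
- by split => // k /BA; exact: XB.
- by move=> nu' /feasibleE; exact: opt.
Qed.

End existence.
(** * Difference of two measures *)
Section measure_difference.
Context d (T : measurableType d) (R : realType).
Variables mu sigma : {measure set T -> \bar R}.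

(** Measures are nonnegative on all sets, while domination is only known on
measurable ones, hence the value [0] elsewhere.  The two hypotheses are
arguments of the function so that the measure structure can be inferred. *)
Definition measure_difference (mu_fin : (mu setT < +oo)%E)
    (sigma_le : forall E, measurable E -> (sigma E <= mu E)%E) (E : set T) :=
  if `[< measurable E >] then (mu E - sigma E)%E else 0%E.

Hypothesis mu_fin : (mu setT < +oo)%E.
Hypothesis sigma_le : forall E, measurable E -> (sigma E <= mu E)%E.

Let delta := measure_difference mu_fin sigma_le.

Let mu_fin_num E : measurable E -> mu E \is a fin_num.
Proof.
move=> mE; rewrite ge0_fin_numE ?measure_ge0//.
by rewrite (le_lt_trans _ mu_fin)// le_measure ?inE.
Qed.

Let sigma_fin_num E : measurable E -> sigma E \is a fin_num.
Proof.
move=> mE; rewrite ge0_fin_numE ?measure_ge0// (le_lt_trans (sigma_le mE))//.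
by rewrite -ge0_fin_numE ?measure_ge0// mu_fin_num.
Qed.

Let deltaE E : measurable E -> delta E = (mu E - sigma E)%E.
Proof. by move=> mE; rewrite /delta /measure_difference asboolT. Qed.

Let delta0 : delta set0 = 0%E.
Proof. by rewrite deltaE// !measure0 sube0. Qed.

Let delta_ge0 E : (0 <= delta E)%E.
Proof.
rewrite /delta /measure_difference; case: asboolP => // mE.
by rewrite sube_ge0 ?sigma_le// sigma_fin_num.
Qed.

Let delta_sigma_additive : semi_sigma_additive delta.
Proof.
move=> F mF tF mUF; rewrite deltaE//.
have -> : (fun N => \sum_(0 <= i < N) delta (F i))%E =
    (fun N => \sum_(0 <= i < N) mu (F i) - \sum_(0 <= i < N) sigma (F i))%E.
  apply/funext => N; rewrite -fin_num_sumeN; last first.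
    by move=> i _; exact: sigma_fin_num.
  by rewrite -big_split/=; apply: eq_bigr => i _; rewrite deltaE.
apply: cvgeB; [|exact: measure_semi_sigma_additive..].
by rewrite fin_num_adde_defl// fin_numN sigma_fin_num.
Qed.

HB.instance Definition _ := isMeasure.Build _ T R
  (measure_difference mu_fin sigma_le) delta0 delta_ge0 delta_sigma_additive.

Lemma measure_differenceK E : measurable E ->
  (sigma E + measure_difference mu_fin sigma_le E = mu E)%E.
Proof.
by move=> mE; rewrite [X in (_ + X)%E]deltaE// addeC subeK// sigma_fin_num.
Qed.

End measure_difference.

(** * Partitions and subpartitions of a compact space *)
Section translation.
Context (R : realType) (X : ptopologicalType).
Hypothesis X_compact : compact [set: X].
Variable mu : probability (borel X) R.
Variable N : nat.
Variables psi phi : 'I_N -> X -> R.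
Hypotheses (psi_continuous : forall i, continuous (psi i))
           (phi_continuous : forall i, continuous (phi i)).
Implicit Type m : 'rV[R]_N.

Lemma continuous_bounded_mfun (f : borel X -> R) :
  continuous (f : X -> R) -> bounded_mfun f.
Proof.
move=> cf; split.
  apply: (measurability _ (RGenOpens.measurableE R)) => _ [_ [a [b ->] <-]].
  rewrite setTI; apply: sub_sigma_algebra.
  by move/continuousP : cf; apply; exact: interval_open.
have : bounded_set (f @` setT).
  apply: compact_bounded; apply: (@continuous_compact X) => //.
  exact: continuous_subspaceT.
move=> [C [_ fC]]; exists (C + 1) => x.
by apply: (fC (C + 1)); [rewrite ltrDl | exists x].
Qed.

Let mu1 : mu setT = 1%E. Proof. exact: probability_setT. Qed.
Let mu_fin : (mu setT < +oo)%E. Proof. by rewrite mu1 ltry. Qed.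
Let bpsi i : @bounded_mfun _ (borel X) R (psi i).
Proof. exact: continuous_bounded_mfun. Qed.
Let bphi i : @bounded_mfun _ (borel X) R (phi i).
Proof. exact: continuous_bounded_mfun. Qed.

Definition with_slack (nu : 'I_N -> {measure set (borel X) -> \bar R})
    (delta : {measure set (borel X) -> \bar R}) (k : option 'I_N) :=
  if k is Some i then nu i else delta.

Definition all_goods : {set option 'I_N} := [set~ None]%SET.
Definition goods_and_slack : {set option 'I_N} := finset.setTfor (option 'I_N).

Lemma objectiveE (nu : option 'I_N -> {measure set (borel X) -> \bar R}) :
  splits mu nu ->
  objective phi (fun i => nu (Some i)) = (@payoff _ (borel X) R N phi nu)%:E.
Proof.
move=> snu; rewrite /objective /payoff -sumEFin; apply: eq_bigr => i _.
by rewrite bounded_integralE//; exact: splits_fin snu.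
Qed.

(** Common to partitions and subpartitions: both kinds of tuples correspond to
feasible families, with the slack measure added or dropped. *)
Lemma unique_strong_maximizer_of_optimum (A : {set option 'I_N}) m
    (W : set ('I_N -> {measure set (borel X) -> \bar R}))
    (P : set ('I_N -> set (borel X))) :
  (forall nu, feasible mu psi A m nu -> W (fun i => nu (Some i))) ->
  (forall nu, W nu ->
    exists delta, feasible mu psi A m (with_slack nu delta)) ->
  (forall Y : option 'I_N -> set (borel X),
    [/\ forall k, measurable (Y k), \bigcup_k Y k = setT,
        forall k l, k != l -> mu (Y k `&` Y l) = 0%E
      & forall k, k \notin A -> Y k = set0] ->
    (forall i, \int[mu]_(x in Y (Some i)) (psi i x)%:E = (m 0 i)%:E)%E ->
    P (fun i => Y (Some i))) ->
  strong_optimum mu psi A m phi -> unique_strong_maximizer mu phi W P.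
Proof.
move=> feasW Wfeas cellP [nu [Y [fnu Ypart nuE opt]]].
have [snu nuA num] := fnu.
have objE nu' delta : feasible mu psi A m (with_slack nu' delta) ->
    objective phi nu' = (@payoff _ (borel X) R N phi (with_slack nu' delta))%:E.
  by move=> [snu' _ _]; exact: (objectiveE snu').
exists (fun i => nu (Some i)); split.
- split=> [|nu' /Wfeas[delta fnu']]; first exact: feasW.
  by rewrite (objE _ _ fnu') objectiveE// lee_fin; have [] := opt _ fnu'.
- move=> nu' [/Wfeas[delta fnu'] maxnu'] i E mE.
  have [_ uniq] := opt _ fnu'.
  apply: (uniq _ (Some i) E mE).
  have := maxnu' _ (feasW _ fnu).
  by rewrite objectiveE// (objE _ _ fnu') lee_fin.
- exists (fun i => Y (Some i)); last by move=> i E mE; exact: nuE.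
  apply: cellP => // i; have [mY _ _ _] := Ypart.
  rewrite -(restricted_integral mu_fin (mY (Some i)) (nuE (Some i)))//.
  by rewrite bounded_integralE ?num//; exact: splits_fin snu.
Qed.

Lemma weak_partition_of_feasible m nu :
  feasible mu psi all_goods m nu ->
  weak_partitions mu psi m (fun i => nu (Some i)).
Proof.
move=> [snu nuA num]; split=> [E mE|i].
  rewrite -snu// big_option /= (_ : nu None E = 0%E) ?add0e//.
  by apply: (vanishes_off_eq0 nuA) => //; rewrite !inE.
by rewrite bounded_integralE ?num//; exact: splits_fin snu.
Qed.

Lemma feasible_of_weak_partition m nu : weak_partitions mu psi m nu ->
  exists delta, feasible mu psi all_goods m (with_slack nu delta).
Proof.
move=> [snu num]; exists mzero.
have snu' : splits mu (with_slack nu mzero).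
  by move=> E mE; rewrite big_option /= /mzero add0e snu.
split=> // [[i|]|i]; rewrite ?inE//=.
by rewrite /Rintegral num.
Qed.

Lemma weak_subpartition_of_feasible m nu :
  feasible mu psi goods_and_slack m nu ->
  weak_subpartitions mu psi m (fun i => nu (Some i)).
Proof.
move=> [snu nuA num]; split=> [E mE|i].
  by rewrite -snu// big_option /= leeDr// measure_ge0.
by rewrite bounded_integralE ?num//; exact: splits_fin snu.
Qed.

Lemma feasible_of_weak_subpartition m nu : weak_subpartitions mu psi m nu ->
  exists delta, feasible mu psi goods_and_slack m (with_slack nu delta).
Proof.
move=> [snu num].
have nufin i : (nu i setT < +oo)%E.
  rewrite (le_lt_trans _ mu_fin)// (le_trans _ (snu _ measurableT))//.
  rewrite (bigD1 i)//= leeDl//.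
  by apply: sume_ge0 => l _; exact: measure_ge0.
have [sigma [_ sigmaE _]] := sum_measure (index_enum 'I_N) nufin.
have sigma_le E : measurable E -> (sigma E <= mu E)%E.
  by move=> mE; rewrite sigmaE snu.
exists (measure_difference mu_fin sigma_le); split.
- by move=> E mE; rewrite big_option /= -sigmaE addeC measure_differenceK.
- by move=> k; rewrite inE.
- by move=> i; rewrite /Rintegral /= num.
Qed.

Lemma strong_partition_of_cells m (Y : option 'I_N -> set (borel X)) :
  [/\ forall k, measurable (Y k), \bigcup_k Y k = setT,
      forall k l, k != l -> mu (Y k `&` Y l) = 0%E
    & forall k, k \notin all_goods -> Y k = set0] ->
  (forall i, \int[mu]_(x in Y (Some i)) (psi i x)%:E = (m 0 i)%:E)%E ->
  strong_partitions mu psi m (fun i => Y (Some i)).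
Proof.
move=> [mY YT Y0 YA] Ym; split => //.
- apply/seteqP; split => // x _.
  have : (\bigcup_k Y k) x by rewrite YT.
  move=> [[i|] _ Yx]; first by exists i.
  by move: Yx; rewrite YA// !inE.
- by move=> i j ij; apply: Y0; apply: contra ij => /eqP[->].
Qed.

Lemma strong_subpartition_of_cells m (Y : option 'I_N -> set (borel X)) :
  [/\ forall k, measurable (Y k), \bigcup_k Y k = setT,
      forall k l, k != l -> mu (Y k `&` Y l) = 0%E
    & forall k, k \notin goods_and_slack -> Y k = set0] ->
  (forall i, \int[mu]_(x in Y (Some i)) (psi i x)%:E = (m 0 i)%:E)%E ->
  strong_subpartitions mu psi m (fun i => Y (Some i)).
Proof.
move=> [mY YT Y0 YA] Ym; split => //.
by move=> i j ij; apply: Y0; apply: contra ij => /eqP[->].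
Qed.

(** The slack measure is the restriction of [mu] to the complement of the union;
for a partition this complement is empty, as [coverY] demands when the slack is
not allowed. *)
Lemma strong_subpartition_feasible m Y (A : {set option 'I_N}) :
  strong_subpartitions mu psi m Y ->
  (forall i, Some i \in A) -> (None \notin A -> \bigcup_i Y i = setT) ->
  has_feasible mu psi A m.
Proof.
move=> [mY _ Y0 Ym] iA coverY.
pose C k := if k is Some i then Y i else ~` \bigcup_i Y i.
have mC k : measurable (C k).
  case: k => [i|] /=; first exact: mY.
  by apply: measurableC; apply: fin_bigcup_measurable => // i _; exact: mY.
have C0 k l : k != l -> mu (C k `&` C l) = 0%E.
  case: k l => [i|] [j|] //= ij.
  - by apply: Y0; apply: contra ij => /eqP ->.
  - rewrite (_ : _ `&` _ = set0) ?measure0//.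
    by apply/seteqP; split => // x [Yx]; apply; exists i.
  - rewrite (_ : _ `&` _ = set0) ?measure0//.
    by apply/seteqP; split => // x [+ Yx]; apply; exists j.
exists (fun k => mrestr mu (mC k)); split.
- move=> E mE; rewrite /= /mrestr measure_almost_disjoint ?index_enum_uniq//.
  rewrite -bigcup_seq (_ : \bigcup_(_ in _) _ = setT) ?setIT//.
  apply/seteqP; split => // x _.
  have [[i _ Yx]|Yx] := pselect ((\bigcup_i Y i) x).
    by exists (Some i) => //=; rewrite mem_index_enum.
  by exists None => //=; rewrite mem_index_enum.
- move=> [i|] kA; first by rewrite iA in kA.
  by rewrite /= /mrestr /C coverY// setCT setI0 measure0.
- move=> i; rewrite /Rintegral.
  by rewrite (@restricted_integral _ _ _ mu _ (Y i))// Ym.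
Qed.

(** A tie between the scores of [i] and [j] at prices [p] is the null set of
condition (A) for [a = p_i] and [b = p_j]. *)
Lemma generic_all_goods : condition_A mu psi phi ->
  generic_scores mu psi phi all_goods.
Proof.
move=> condA p [i|] [j|]; rewrite !inE//= => _ _ ij.
rewrite -(condA i j _ (p 0 i) (p 0 j)); last by apply: contra ij => /eqP ->.
have E x : p 0 i * psi i x - p 0 j * psi j x + phi i x - phi j x =
    phi i x + p 0 i * psi i x - (phi j x + p 0 j * psi j x) by ring.
congr (mu _); apply/seteqP; split => x /=; rewrite E.
  by move=> ->; rewrite subrr.
by move/eqP; rewrite subr_eq0 => /eqP.
Qed.

(** A tie with the slack is the null set of condition (B) for [a = - p_i]. *)
Lemma generic_goods_and_slack : condition_A mu psi phi ->
  condition_B mu psi phi -> generic_scores mu psi phi goods_and_slack.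
Proof.
move=> condA condB p.
have slack_tie i : mu [set x | phi i x + p 0 i * psi i x = 0] = 0%E.
  rewrite -(condB i (- p 0 i)); congr (mu _); apply/seteqP; split => x /=.
    by move/eqP; rewrite addr_eq0 mulNr => /eqP.
  by move=> ->; rewrite mulNr addNr.
move=> [i|] [j|] // _ _ ij.
- by apply: generic_all_goods; rewrite // !inE.
- exact: slack_tie.
- by rewrite -[RHS](slack_tie j); congr (mu _); apply/seteqP; split => x /= ->.
Qed.

Lemma condition_C_generic : condition_C mu psi -> forall i j, i != j ->
  forall a b : R, a != 0 -> mu [set x | a * psi i x = b * psi j x] = 0%E.
Proof.
move=> [_ condC] i j ij a b a0; rewrite -(condC i j ij a (- b)).
  congr (mu _); apply/seteqP; split => x /=.
    by move=> ->; rewrite mulNr subrr.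
  by move/eqP; rewrite mulNr subr_eq0 => /eqP.
by rewrite ltr_pwDl ?sqr_ge0// lt_neqAle sqr_ge0 andbT eq_sym sqrf_eq0.
Qed.

Lemma partition_set_feasible m : partition_set mu psi m ->
  has_feasible mu psi all_goods m.
Proof.
move=> [Y [mY YT Y0 Ym]]; apply: (@strong_subpartition_feasible m Y) => //.
by move=> i; rewrite !inE.
Qed.

Lemma subpartition_set_feasible m : subpartition_set mu psi m ->
  has_feasible mu psi goods_and_slack m.
Proof.
move=> [Y PY].
by apply: (strong_subpartition_feasible PY) => [i|]; rewrite !inE.
Qed.

End translation.

Theorem theorem4p1 (R : realType) (X : ptopologicalType)
  (X_compact : compact [set: X]) (X_polish : polish_space R X)
  (mu : probability (borel X) R) (mu_non_atomic : non_atomic mu)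
  (N : nat) (psi : 'I_N -> X -> R) (psi_continuous : forall i, continuous (psi i))
  (phi : 'I_N -> X -> R) (phi_continuous : forall i, continuous (phi i)) :
  [/\ (* (i) *)
      condition_A mu psi phi ->
        forall m : 'rV[R]_N, (partition_set mu psi)° m ->
          unique_strong_maximizer mu phi
            (weak_partitions mu psi m) (strong_partitions mu psi m),
      (* (ii) *)
      condition_A mu psi phi -> condition_B mu psi phi ->
        forall m : 'rV[R]_N, (subpartition_set mu psi)° m ->
          unique_strong_maximizer mu phi
            (weak_subpartitions mu psi m) (strong_subpartitions mu psi m)
    & (* (iii) *)
      (condition_A mu psi phi -> condition_C mu psi ->
        forall m : 'rV[R]_N, partition_set mu psi m ->
          unique_strong_maximizer mu phi
            (weak_partitions mu psi m) (strong_partitions mu psi m)) /\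
      (condition_A mu psi phi -> condition_B mu psi phi -> condition_C mu psi ->
        forall m : 'rV[R]_N, subpartition_set mu psi m ->
          unique_strong_maximizer mu phi
            (weak_subpartitions mu psi m) (strong_subpartitions mu psi m))].
Proof.
have mu1 : mu setT = 1%E by exact: probability_setT.
have bpsi i : @bounded_mfun _ (borel X) R (psi i).
  exact: continuous_bounded_mfun.
have bphi i : @bounded_mfun _ (borel X) R (phi i).
  exact: continuous_bounded_mfun.
have full m : strong_optimum mu psi (all_goods N) m phi ->
    unique_strong_maximizer mu phi (weak_partitions mu psi m)
      (strong_partitions mu psi m).
  apply: unique_strong_maximizer_of_optimum => //.
  - by move=> nu; exact: weak_partition_of_feasible.
  - by move=> nu; exact: feasible_of_weak_partition.
  - by move=> Y; exact: strong_partition_of_cells.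
have sub m : strong_optimum mu psi (goods_and_slack N) m phi ->
    unique_strong_maximizer mu phi (weak_subpartitions mu psi m)
      (strong_subpartitions mu psi m).
  apply: unique_strong_maximizer_of_optimum => //.
  - by move=> nu; exact: weak_subpartition_of_feasible.
  - by move=> nu; exact: feasible_of_weak_subpartition.
  - by move=> Y; exact: strong_subpartition_of_cells.
split; [move=> condA m Sm | move=> condA condB m Sm |
  split=> [condA condC m Sm | condA condB condC m Sm]].
- apply/full/(interior_strong_optimum mu1 bpsi bphi (generic_all_goods condA)).
  by apply: filterS Sm => m'; exact: partition_set_feasible.
- apply/sub/(interior_strong_optimum mu1 bpsi bphi
    (generic_goods_and_slack condA condB)).
  by apply: filterS Sm => m'; exact: subpartition_set_feasible.
- apply/full/(strong_optimum_exists mu1 bpsi bphi).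
  + by case: condC.
  + exact: condition_C_generic.
  + exact: generic_all_goods.
  + exact: partition_set_feasible.
- apply/sub/(strong_optimum_exists mu1 bpsi bphi).
  + by case: condC.
  + exact: condition_C_generic.
  + exact: generic_goods_and_slack.
  + exact: subpartition_set_feasible.
Qed.
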